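(* Let $A$ be the class of $(2K_2,C_4)$-free graphs. For all integers $a,b\ge 3$, $$R_A(a,b)=a+b.$$
   Context: All graphs are finite, undirected, without loops or multiple edges. $2K_2$ is the disjoint union of two edges (4 vertices) and $C_4$ is the chordless cycle on 4 vertices. A graph is $(H_1,\dots,H_k)$-free if it contains none of $H_1,\dots,H_k$ as an induced subgraph. For a class $A$ of graphs, $R_A(a,b)$ is the minimum $n$ such that every graph in $A$ with at least $n$ vertices has either a clique of size $a$ or an independent set of size $b$. *)

(* Defs.v *)
(* MathComp *)
From Stdlib Require List.
From HB Require Import structures.
From mathcomp Require Import all_boot.

Set Implicit Arguments.
Unset Strict Implicit.
Unset Printing Implicit Defensive.

Record sgraph := SGraph {
  vertex :> finType;
  adj : rel vertex;
  adj_sym : symmetric adj;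
  adj_irr : irreflexive adj }.

Definition complete_adj n : rel 'I_n := [rel x y | x != y].

Lemma complete_adj_sym n : symmetric (@complete_adj n).
Proof. by move=> x y; rewrite /complete_adj /= eq_sym. Qed.

Lemma complete_adj_irr n : irreflexive (@complete_adj n).
Proof. by move=> x; rewrite /complete_adj /= eqxx. Qed.

Definition complete_graph n : sgraph :=
  SGraph (@complete_adj_sym n) (@complete_adj_irr n).

Definition union_adj (G H : sgraph) : rel (G + H)%type := fun u v =>
  match u, v with
  | inl x, inl y => adj x y
  | inr x, inr y => adj x y
  | _, _ => false
  end.

Lemma union_adj_sym G H : symmetric (@union_adj G H).
Proof. by move=> [x|x] [y|y] //=; apply: adj_sym. Qed.

Lemma union_adj_irr G H : irreflexive (@union_adj G H).
Proof. by move=> [x|x] /=; apply: adj_irr. Qed.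

Definition disjoint_union (G H : sgraph) : sgraph :=
  SGraph (@union_adj_sym G H) (@union_adj_irr G H).

Definition twoK2 : sgraph :=
  disjoint_union (complete_graph 2) (complete_graph 2).

Definition C4_adj : rel 'I_4 :=
  [rel x y : 'I_4 | (y == x.+1 %% 4 :> nat) || (x == y.+1 %% 4 :> nat)].

Lemma C4_adj_sym : symmetric C4_adj.
Proof. by move=> x y; rewrite /C4_adj /= orbC. Qed.

Lemma C4_adj_irr : irreflexive C4_adj.
Proof. by case=> [[|[|[|[|m]]]] Hm]. Qed.

Definition C4 : sgraph := SGraph C4_adj_sym C4_adj_irr.

Definition contains_induced (G H : sgraph) : Prop :=
  exists2 f : H -> G, injective f & forall x y, adj (f x) (f y) = adj x y.

Definition free_of (Hs : seq sgraph) (G : sgraph) : Prop :=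
  forall H, List.In H Hs -> ~ contains_induced G H.

Definition is_clique (G : sgraph) (K : {set G}) : Prop :=
  {in K &, forall x y, x != y -> adj x y}.

Definition is_independent (G : sgraph) (S : {set G}) : Prop :=
  {in S &, forall x y, ~~ adj x y}.

Definition ramsey_bound (A : sgraph -> Prop) (a b n : nat) : Prop :=
  forall G : sgraph, A G -> n <= #|G| ->
    (exists2 K : {set G}, is_clique K & #|K| = a) \/
    (exists2 S : {set G}, is_independent S & #|S| = b).

(* R_A(a, b) = n *)
Definition is_ramsey_number (A : sgraph -> Prop) (a b n : nat) : Prop :=
  ramsey_bound A a b n /\ forall m, ramsey_bound A a b m -> n <= m.

(* Main.v *)
Require Import Defs.
From mathcomp Require Import all_boot.

(* Upper bound: a (2K2, C4)-free graph is either split, or consists of an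
   induced 5-cycle, a clique joined completely to it and an independent set
   with no edge to it; in both cases its order is at most omega + alpha + 1.
   The second kind, with clique of size a - 3 and independent set of size b - 3
   having no edge between them, gives a graph of order a + b - 1 with
   omega = a - 1 and alpha = b - 1. *)

(** * Subsets of given size, cliques and independent sets *)

Lemma subset_of_card {T : finType} (A : {set T}) (k : nat) :
  k <= #|A| -> exists2 B : {set T}, B \subset A & #|B| = k.
Proof.
case/card_geqP=> s [us <- sA]; exists [set x in s].
  by apply/subsetP=> x; rewrite inE; apply: sA.
by rewrite cardsE; apply/card_uniqP.
Qed.

Section Graph.

Variable G : sgraph.
Implicit Types (u v w x y z t : G) (K S : {set G}).

Lemma adj_neq x y : adj x y -> x != y.
Proof. by apply: contraTneq => ->; rewrite adj_irr. Qed.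

Lemma is_cliqueP K :
  reflect (is_clique K)
    [forall x in K, forall y in K, (x != y) ==> adj x y].
Proof.
apply: (iffP forall_inP) => [h x y xK yK xy | h x xK].
  by have /forall_inP/(_ y yK)/implyP := h x xK; apply.
by apply/forall_inP=> y yK; apply/implyP; apply: h.
Qed.

Lemma is_cliqueS K K' : K' \subset K -> is_clique K -> is_clique K'.
Proof. by move=> /subsetP sK h x y /sK xK /sK yK; apply: h. Qed.

Lemma is_independentS S S' :
  S' \subset S -> is_independent S -> is_independent S'.
Proof. by move=> /subsetP sS h x y /sS xS /sS yS; apply: h. Qed.

Lemma is_cliqueU1 x K :
  is_clique K -> {in K, forall u, adj x u} -> is_clique (x |: K).
Proof.
move=> cK xK u v /setU1P[->|uK] /setU1P[->|vK] uv; last exact: cK.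
- by rewrite eqxx in uv.
- exact: xK.
- by rewrite adj_sym xK.
Qed.

Lemma is_independentU1 x S :
  is_independent S -> {in S, forall u, ~~ adj x u} ->
  is_independent (x |: S).
Proof.
move=> iS xS u v /setU1P[->|uS] /setU1P[->|vS]; last exact: iS.
- by rewrite adj_irr.
- exact: xS.
- by rewrite adj_sym xS.
Qed.

(** * The two forbidden subgraphs as adjacency rules *)

(** Coinciding ends are covered by the conclusion itself: if [x = z], for instance, then [adj x t]
    is the edge [zt]. So when all four disjuncts fail the vertices are distinct and induce a 2K2. *)
Lemma twoK2_free_adj x y z t :
  ~ contains_induced G twoK2 -> adj x y -> adj z t ->
  [|| adj x z, adj x t, adj y z | adj y t].
Proof.
move=> free xy zt; apply/negP=> /negP; rewrite !negb_or => /and4P[xz xt yz yt].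
have [yx tz] : adj y x /\ adj t z by rewrite !(adj_sym y) !(adj_sym t).
have [zx tx] : ~~ adj z x /\ ~~ adj t x by rewrite !(adj_sym z) !(adj_sym t).
have [zy ty] : ~~ adj z y /\ ~~ adj t y by rewrite !(adj_sym z) !(adj_sym t).
pose f (i : 'I_2 + 'I_2) :=
  match i with
  | inl i => if i == 0 :> nat then x else y
  | inr i => if i == 0 :> nat then z else t
  end.
have fadj (i j : twoK2) : adj (f i) (f j) = adj i j.
  by move: i j => [] [[|[|i]] hi] [] [[|[|j]] hj] //=;
     rewrite ?adj_irr ?xy ?yx ?zt ?tz //; apply: negbTE.
have uf : uniq [:: x; y; z; t].
  rewrite /= !inE !negb_or (adj_neq x y) // (adj_neq z t) // !andbT /=.
  by apply/andP; split; apply/andP; split;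
    [apply: contraNneq xt | apply: contraNneq xz
    |apply: contraNneq yt | apply: contraNneq yz] => ->.
apply: free; exists f => // i j fij.
(* Numbering the vertices of 2K2 from 0 to 3 turns injectivity of [f] into [uniq] of the list of
   images. *)
pose pos (k : 'I_2 + 'I_2) := match k with inl k => nat_of_ord k | inr k => k.+2 end.
have fE k : f k = nth x [:: x; y; z; t] (pos k).
  by case: k => [] [[|[|k]] hk].
have pos_lt k : pos k < 4.
  by case: k => [] [[|[|k]] hk].
move: fij; rewrite !fE => /eqP; rewrite nth_uniq ?pos_lt // => /eqP {fE pos_lt}.
case: i j => [[[|[|i]] hi]|[[|[|i]] hi]] [[[|[|j]] hj]|[[|[|j]] hj]] // _;
  by congr (_ _); apply: val_inj.
Qed.

Lemma C4_free_adj x y z t :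
  ~ contains_induced G C4 -> adj x y -> adj y z -> adj z t -> adj t x ->
  x != z -> y != t -> adj x z || adj y t.
Proof.
move=> free xy yz zt tx nxz nyt; apply/negP=> /negP; rewrite negb_or => /andP[xz yt].
have [yx zy] : adj y x /\ adj z y by rewrite (adj_sym y) (adj_sym z).
have [tz xt] : adj t z /\ adj x t by rewrite (adj_sym t) (adj_sym x).
have [zx ty] : ~~ adj z x /\ ~~ adj t y by rewrite (adj_sym z) (adj_sym t).
pose f (i : 'I_4) := nth x [:: x; y; z; t] i.
have uf : uniq [:: x; y; z; t].
  by rewrite /= !inE !negb_or nxz nyt !adj_neq.
apply: free; exists f => [i j /eqP | i j].
  by rewrite nth_uniq // => /eqP/val_inj.
by case: i j => [[|[|[|[|i]]]] hi] [[|[|[|[|j]]]] hj] //=;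
  rewrite /f /= ?adj_irr // ?xy ?yz ?zt ?tx ?yx ?zy ?tz ?xt //; apply: negbTE.
Qed.

(** * Split graphs and induced 5-cycles *)

(** Distinctness follows from the pattern: [v1 = v3], say, would make [v4 v1] an edge. The diagonals
    are oriented cyclically, so that a rotation only permutes the conjuncts. *)
Definition is_induced_C5 v1 v2 v3 v4 v5 :=
  [&& adj v1 v2, adj v2 v3, adj v3 v4, adj v4 v5 & adj v5 v1] &&
  [&& ~~ adj v1 v3, ~~ adj v2 v4, ~~ adj v3 v5, ~~ adj v4 v1 & ~~ adj v5 v2].

Lemma is_induced_C5_rot v1 v2 v3 v4 v5 :
  is_induced_C5 v1 v2 v3 v4 v5 -> is_induced_C5 v2 v3 v4 v5 v1.
Proof.
case/andP=> /and5P[e1 e2 e3 e4 e5] /and5P[n1 n2 n3 n4 n5].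
by apply/andP; split; apply/and5P.
Qed.

Hypothesis free : free_of [:: twoK2; C4] G.

Let twoK2_free : ~ contains_induced G twoK2.
Proof. by apply: free; left. Qed.

Let C4_free : ~ contains_induced G C4.
Proof. by apply: free; right; left. Qed.

Let deg v := #|[set u | adj v u]|.

(* Among the maximum cliques [K] choose one with the largest degree sum, that
   is, with the fewest edges outside [K].  If [xy] is an edge outside [K], then
   exchanging [x] with its unique non-neighbour [z] in [K] cannot improve [K],
   and this provides the vertex [t] which closes the 5-cycle. *)
Lemma split_or_induced_C5 :
  (exists2 K : {set G}, is_clique K & is_independent (~: K)) \/
  (exists v1 v2 v3 v4 v5, is_induced_C5 v1 v2 v3 v4 v5).
Proof.
pose cl (K : {set G}) := [forall x in K, forall y in K, (x != y) ==> adj x y].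
have cl0 : cl set0 by apply/is_cliqueP=> x y; rewrite inE.
case: (arg_maxnP (fun K : {set G} => #|K|) cl0) => K0 clK0 maxK0.
have cl1 : cl K0 && (#|K0| == #|K0|) by rewrite clK0 eqxx.
case: (arg_maxnP (P := fun K => cl K && (#|K| == #|K0|))
    (fun K : {set G} => \sum_(v in K) deg v) cl1)
  => K /andP[/is_cliqueP cK /eqP eqK] maxK {cl1 cl0}.
have {clK0} big K' : is_clique K' -> #|K'| <= #|K|.
  by move/is_cliqueP=> clK'; rewrite eqK; apply: maxK0.
have {maxK} heavy K' : is_clique K' -> #|K'| = #|K| ->
    \sum_(v in K') deg v <= \sum_(v in K) deg v.
  by move=> /is_cliqueP clK' eK'; apply: maxK; rewrite [cl K']clK' eK' eqK eqxx.
(* By [sub] the neighbours of [y] in [K] are among those of [x]. Every edge outside [K] satisfies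
   this in one of its two directions. *)
have key x y : x \notin K -> y \notin K -> adj x y ->
    {in K, forall u, ~~ adj x u -> ~~ adj y u} ->
    exists v1 v2 v3 v4 v5, is_induced_C5 v1 v2 v3 v4 v5.
  move=> xK yK xy sub.
  have [z zK xz] : exists2 z, z \in K & ~~ adj x z.
    apply/exists_inP; rewrite -negb_forall_in; apply/negP=> /forall_inP xall.
    by have := big _ (is_cliqueU1 _ _ cK xall); rewrite cardsU1 xK ltnn.
  have yz := sub _ zK xz.
  (* A second non-neighbour [u] of [x] in [K] would give a 2K2 on the edges [xy] and [zu]. *)
  have xall : {in K :\ z, forall u, adj x u}.
    move=> u /setD1P[uz uK]; apply: contraT => xu.
    have zu : adj z u by apply: cK => //; rewrite eq_sym.
    have := twoK2_free_adj _ _ _ _ twoK2_free xy zu.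
    by rewrite (negbTE xu) (negbTE xz) (negbTE yz) (negbTE (sub _ uK xu)).
  have cK' : is_clique (x |: (K :\ z)).
    by apply: is_cliqueU1 => //; apply: is_cliqueS cK; apply: subD1set.
  have xK' : x \notin K :\ z by rewrite !inE negb_and xK orbT.
  have cardK' : #|x |: (K :\ z)| = #|K|.
    by rewrite cardsU1 xK' (cardsD1 z K) zK.
  (* Otherwise adding both [x] and [y] to [K :\ z] would give a clique larger than [K]. *)
  have [w /setD1P[wz wK] yw] : exists2 w, w \in K :\ z & ~~ adj y w.
    apply/exists_inP; rewrite -negb_forall_in; apply/negP=> /forall_inP yall.
    have cK'' : is_clique (y |: (x |: (K :\ z))).
      apply: is_cliqueU1 => // u /setU1P[-> | /yall //].
      by rewrite adj_sym.
    have := big _ cK''; rewrite cardsU1 cardK' !inE (negbTE yK) andbF orbF.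
    by rewrite eq_sym adj_neq // ltnn.
  have xw : adj x w by apply: xall; rewrite !inE wz.
  have degxz : deg x <= deg z.
    have := heavy _ cK' cardK'; rewrite big_setU1 //= (big_setD1 z zK) /=.
    by rewrite leq_add2r.
  (* The neighbourhood of [z] cannot lie inside that of [x]: the inclusion would be strict because
     of [y], against [degxz]. *)
  have [t zt xt] : exists2 t, adj z t & ~~ adj x t.
    apply/exists_inP; rewrite -negb_forall_in; apply/negP=> /forall_inP sub'.
    suff : deg z < deg x by rewrite ltnNge degxz.
    apply: proper_card; apply/properP; split.
      by apply/subsetP=> u; rewrite !inE; apply: sub'.
    by exists y; rewrite !inE // adj_sym.
  have yt : adj y t.
    have := twoK2_free_adj _ _ _ _ twoK2_free xy zt.
    by rewrite (negbTE xt) (negbTE xz) (negbTE yz).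
  have wz1 : adj w z by apply: cK.
  have tw : ~~ adj t w.
    apply/negP=> tw.
    have := C4_free_adj x y t w C4_free xy yt tw.
    rewrite adj_sym xw (negbTE xt) (negbTE yw).
    have -> : x != t by apply: contraNneq xz => ->; rewrite adj_sym.
    have -> : y != w by apply: contraNneq yK => ->.
    by move=> /(_ isT isT isT).
  exists x, y, t, z, w; rewrite /is_induced_C5 xy yt (adj_sym t) zt (adj_sym z) wz1.
  by rewrite (adj_sym w) xw xt yz tw (adj_sym z) xz (adj_sym w) yw.
case: (boolP [exists x in ~: K, exists y in ~: K, adj x y]).
  case/exists_inP=> x xK /exists_inP[y yK xy]; right.
  rewrite !inE in xK yK.
  (* The neighbourhoods of [x] and [y] in [K] are nested: a vertex [u] seen only by [y] and a vertex
     [v] seen only by [x] would close an induced 4-cycle [x y u v]. *)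
  case: (boolP [forall u in K, ~~ adj x u ==> ~~ adj y u]).
    by move/forall_inP=> h; apply: (key x y) => // u /h/implyP.
  rewrite negb_forall_in => /exists_inP[u uK]; rewrite negb_imply negbK.
  case/andP=> xu yu.
  apply: (key y x) => // [|v vK yv]; first by rewrite adj_sym.
  apply/negP=> xv.
  have uv : u != v by apply: contraNneq yv => <-.
  have := C4_free_adj x y u v C4_free xy yu (cK _ _ uK vK uv).
  rewrite adj_sym xv (negbTE xu) (negbTE yv).
  have -> : x != u by apply: contraNneq xK => ->.
  have -> : y != v by apply: contraNneq yK => ->.
  by move=> /(_ isT isT isT).
rewrite negb_exists_in => /forall_inP h; left; exists K => // x y xK yK.
by have := h x xK; rewrite negb_exists_in => /forall_inP; apply.
Qed.

(** If [v] sees one cycle vertex, the opposite edge forces it to see an end of that edge, by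
    2K2-freeness. If it sees two vertices at distance two, it sees the one between them, by
    C4-freeness. Applied in all five rotations, these rules leave only all or none. *)
Lemma induced_C5_full_or_empty v1 v2 v3 v4 v5 v :
  is_induced_C5 v1 v2 v3 v4 v5 -> v \notin [:: v1; v2; v3; v4; v5] ->
  [&& adj v v1, adj v v2, adj v v3, adj v v4 & adj v v5] ||
  [&& ~~ adj v v1, ~~ adj v v2, ~~ adj v v3, ~~ adj v v4 & ~~ adj v v5].
Proof.
have step u1 u2 u3 u4 u5 : is_induced_C5 u1 u2 u3 u4 u5 -> u2 != v ->
    adj v u1 ==> (adj v u3 || adj v u4) && (adj v u3 ==> adj v u2).
  case/andP=> /and5P[e12 e23 e34 e45 e51] /and5P[n13 n24 n35 n41 n52] u2v.
  apply/implyP=> vu1.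
  apply/andP; split.
    have := twoK2_free_adj _ _ _ _ twoK2_free vu1 e34.
    by rewrite (negbTE n13) (adj_sym u1) (negbTE n41) !orbF.
  apply/implyP=> vu3; rewrite adj_sym.
  have := C4_free_adj u1 u2 u3 v C4_free e12 e23.
  rewrite adj_sym vu3 vu1 (negbTE n13) u2v.
  have -> : u1 != u3 by apply: contraNneq n41 => ->; rewrite adj_sym.
  by move=> /(_ isT isT isT isT).
move=> C5a; rewrite !inE !negb_or => /and5P[].
rewrite !(eq_sym v) => nv1 nv2 nv3 nv4 nv5.
have C5b := is_induced_C5_rot _ _ _ _ _ C5a.
have C5c := is_induced_C5_rot _ _ _ _ _ C5b.
have C5d := is_induced_C5_rot _ _ _ _ _ C5c.
have C5e := is_induced_C5_rot _ _ _ _ _ C5d.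
move: (step _ _ _ _ _ C5a nv2) (step _ _ _ _ _ C5b nv3) (step _ _ _ _ _ C5c nv4)
  (step _ _ _ _ _ C5d nv5) (step _ _ _ _ _ C5e nv1).
by case: (adj v v1); case: (adj v v2); case: (adj v v3); case: (adj v v4);
  case: (adj v v5).
Qed.

(** In the 5-cycle case [F] is a clique, since two non-adjacent members would form a C4 with [v1]
    and [v3], and [E] is independent, since an edge in it would form a 2K2 with [v1 v2]. Adding two
    adjacent cycle vertices to [F] and two non-adjacent ones to [E] accounts for four of the five
    cycle vertices, whence the successor. *)
Lemma clique_independent_card :
  exists K S, [/\ is_clique K, is_independent S & #|G| <= (#|K| + #|S|).+1].
Proof.
have [[K cK iK]|] := split_or_induced_C5.
  by exists K, (~: K); split=> //; rewrite cardsC.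
case=> v1 [v2 [v3 [v4 [v5 C5v]]]].
pose F := [set v | [&& adj v v1, adj v v2, adj v v3, adj v v4 & adj v v5]].
pose E := [set v | [&& ~~ adj v v1, ~~ adj v v2, ~~ adj v v3, ~~ adj v v4 & ~~ adj v v5]].
have /andP[/and5P[e12 e23 e34 e45 e51] /and5P[n13 n24 n35 n41 n52]] := C5v.
have cF : is_clique F.
  move=> x y; rewrite !inE => /and5P[x1 _ x3 _ _] /and5P[y1 _ y3 _ _] xy.
  have := C4_free_adj x v1 y v3 C4_free x1.
  rewrite (adj_sym v1) (adj_sym v3) y1 y3 x3 xy (negbTE n13) orbF.
  have -> : v1 != v3 by apply: contraNneq n41 => ->; rewrite adj_sym.
  by move=> /(_ isT isT isT isT isT).
have iE : is_independent E.
  move=> x y; rewrite !inE => /and5P[x1 x2 _ _ _] /and5P[y1 y2 _ _ _].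
  apply/negP=> xy; have := twoK2_free_adj _ _ _ _ twoK2_free xy e12.
  by rewrite (negbTE x1) (negbTE x2) (negbTE y1) (negbTE y2).
exists (v1 |: (v2 |: F)), (v1 |: (v3 |: E)); split.
- apply: is_cliqueU1; first apply: is_cliqueU1 => //.
    by move=> u; rewrite inE (adj_sym v2) => /and5P[].
  by move=> u /setU1P[-> //|]; rewrite inE (adj_sym v1) => /and5P[].
- apply: is_independentU1; first apply: is_independentU1 => //.
    by move=> u; rewrite inE (adj_sym v3) => /and5P[].
  by move=> u /setU1P[-> //|]; rewrite inE (adj_sym v1) => /and5P[].
have v1F : v1 \notin v2 |: F by rewrite !inE adj_irr orbF adj_neq.
have v2F : v2 \notin F by rewrite !inE adj_irr !andbF.
have v1E : v1 \notin v3 |: E.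
  rewrite !inE e12 /= !andbF orbF.
  by apply: contraNneq n41 => ->; rewrite adj_sym.
have v3E : v3 \notin E by rewrite !inE e34 /= !andbF.
rewrite !cardsU1 v1F v2F v1E v3E.
have cover : [set: G] \subset [set:: [:: v1; v2; v3; v4; v5]] :|: (F :|: E).
  apply/subsetP=> v _; rewrite inE; case: (boolP (v \in [set:: _])) => //=.
  rewrite inE => /(induced_C5_full_or_empty _ _ _ _ _ _ C5v).
  by rewrite !inE.
have := subset_leq_card cover; rewrite cardsT => /leq_trans -> //.
apply: leq_trans (leq_card_setU _ _) _.
have -> : (true + (true + #|F|) + (true + (true + #|E|))).+1 = 5 + (#|F| + #|E|).
  by rewrite !add1n !addSn !addnS.
apply: leq_add; last exact: leq_card_setU.
by rewrite cardsE; apply: (card_size [:: v1; v2; v3; v4; v5]).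
Qed.

End Graph.

(** * The upper bound on the Ramsey number *)

Lemma ramsey_bound_add (a b : nat) :
  ramsey_bound (free_of [:: twoK2; C4]) a.+1 b.+1 (a.+1 + b.+1).
Proof.
move=> G /clique_independent_card[K [S [cK iS cardG]]] n_le.
(* The lost vertex still leaves [a + b < #|K| + #|S|], so [#|K| <= a] forces [b < #|S|]. *)
have := leq_trans n_le cardG; rewrite addSn ltnS addnS => lt_ab.
have [aK|Ka] := leqP a.+1 #|K|.
  have [K' sK' cardK'] := subset_of_card _ _ aK.
  by left; exists K' => //; apply: is_cliqueS cK.
have bS : b < #|S|.
  by rewrite -(ltn_add2l a); apply: leq_trans lt_ab _; rewrite leq_add2r.
have [S' sS' cardS'] := subset_of_card _ _ bS.
by right; exists S' => //; apply: is_independentS iS.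
Qed.

(** * The extremal graph and its freeness *)

Section Extremal.

Variables p q : nat.

Definition C5_adj (i j : 'I_5) : bool :=
  (j == i.+1 %% 5 :> nat) || (i == j.+1 %% 5 :> nat).

(** The three summands are the 5-cycle, the clique joined to it and the isolated vertices. The
    default [u != v] gives both the clique and the join, as elements of different summands
    differ. *)
Definition extremal_adj : rel ('I_5 + ('I_p + 'I_q))%type := fun u v =>
  match u, v with
  | inl i, inl j => C5_adj i j
  | inr (inr _), _ | _, inr (inr _) => false
  | _, _ => u != v
  end.

Lemma extremal_adj_sym : symmetric extremal_adj.
Proof.
by move=> [i|[i|i]] [j|[j|j]] //=; rewrite 1?eq_sym // /C5_adj orbC.
Qed.

Lemma extremal_adj_irr : irreflexive extremal_adj.
Proof. by move=> [[[|[|[|[|[|i]]]]] hi]|[i|i]] //=; rewrite eqxx. Qed.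

Definition extremal_graph : sgraph := SGraph extremal_adj_sym extremal_adj_irr.

Lemma card_extremal_graph : #|extremal_graph| = 5 + (p + q).
Proof. by rewrite !card_sum !card_ord. Qed.

(* In an induced copy of [H] no vertex is isolated and none is joined to all
   the others, so the copy lies inside the 5-cycle. *)
Lemma extremal_graph_induced (H : sgraph) (f : H -> extremal_graph) :
  injective f -> (forall x y, adj (f x) (f y) = adj x y) ->
  (forall x : H, [exists y, adj x y] && [exists y, (x != y) && ~~ adj x y]) ->
  exists2 g : H -> 'I_5, injective g & forall x y, C5_adj (g x) (g y) = adj x y.
Proof.
move=> finj fadj nontriv.
have nonisol x : exists y, adj (f x) (f y).
  by have /andP[/existsP[y xy] _] := nontriv x; exists y; rewrite fadj.
have finl x : exists i, f x = inl i.
  case fx: (f x) => [i|[i|i]]; first by exists i.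
    (* A vertex of the clique part misses only isolated vertices, but [f y] has a neighbour. *)
    have /andP[_ /existsP[y /andP[nxy]]] := nontriv x.
    have [z yz] := nonisol y.
    have fxy : f x != f y by apply: contra nxy => /eqP/finj->.
    rewrite -fadj fx /=; move: yz fxy; rewrite fx.
    by case: (f y) => [j|[j|j]] //= _ ->.
  by have [y] := nonisol x; rewrite fx.
(* By [finl] the default [ord0] is never taken. *)
pose g x := if f x is inl i then i else ord0.
exists g => x y; rewrite -?fadj /g;
  have [i fxi] := finl x; have [j fyj] := finl y; rewrite fxi fyj // => eij.
by apply: finj; rewrite fxi fyj eij.
Qed.

Lemma extremal_graph_free : free_of [:: twoK2; C4] extremal_graph.
Proof.
move=> H [<-|[<-|//]] [f finj fadj].
  have [|g ginj gadj] := extremal_graph_induced _ _ finj fadj.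
    move=> [] [[|[|i]] hi] //; apply/andP; split; apply/existsP.
    - by exists (inl ord_max).
    - by exists (inr ord0).
    - by exists (inl ord0).
    - by exists (inr ord0).
    - by exists (inr ord_max).
    - by exists (inl ord0).
    - by exists (inr ord0).
    - by exists (inl ord0).
  (* Exhaustive check over the 5-cycle: the six adjacencies of 2K2 are incompatible with every
     choice of four images. *)
  move: (gadj (inl ord0) (inl ord_max)) (gadj (inr ord0) (inr ord_max))
    (gadj (inl ord0) (inr ord0)) (gadj (inl ord0) (inr ord_max))
    (gadj (inl ord_max) (inr ord0)) (gadj (inl ord_max) (inr ord_max)).
  case: (g (inl ord0)) => [[|[|[|[|[|x]]]]] hx] //;
  case: (g (inl ord_max)) => [[|[|[|[|[|y]]]]] hy] //;
  case: (g (inr ord0)) => [[|[|[|[|[|z]]]]] hz] //;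
  by case: (g (inr ord_max)) => [[|[|[|[|[|t]]]]] ht].
have [|g ginj gadj] := extremal_graph_induced _ _ finj fadj.
  move=> x; apply/andP; split; apply/existsP.
    by exists (inord (x.+1 %% 4)); rewrite /= /C4_adj /= inordK ?ltn_pmod // eqxx.
  exists (inord (x.+2 %% 4)); rewrite -val_eqE /= /C4_adj /= !inordK ?ltn_pmod //.
  by case: x => [[|[|[|[|x]]]] hx].
pose o n : C4 := inord n : 'I_4.
have oE i j : i < 4 -> j < 4 ->
    C5_adj (g (o i)) (g (o j)) = (j == i.+1 %% 4) || (i == j.+1 %% 4).
  by move=> i4 j4; rewrite gadj /= /C4_adj /= !inordK.
have neq i j : i < 4 -> j < 4 -> i != j -> g (o i) != g (o j) :> nat.
  move=> i4 j4; apply: contra => /eqP/val_inj/ginj/(congr1 (@nat_of_ord 4)).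
  by rewrite !inordK // => ->.
(* The four edges and the distinctness of opposite vertices suffice: the 5-cycle contains no
   4-cycle, induced or not. *)
move: (oE 0 1 isT isT) (oE 1 2 isT isT) (oE 2 3 isT isT) (oE 3 0 isT isT)
  (neq 0 2 isT isT isT) (neq 1 3 isT isT isT) => {oE neq}.
case: (g (o 0)) => [[|[|[|[|[|x]]]]] hx] //;
case: (g (o 1)) => [[|[|[|[|[|y]]]]] hy] //;
case: (g (o 2)) => [[|[|[|[|[|z]]]]] hz] //;
by case: (g (o 3)) => [[|[|[|[|[|t]]]]] ht].
Qed.

(** * Cliques and independent sets of the extremal graph *)

Lemma C5_clique_card (A : {set 'I_5}) :
  {in A &, forall i j, i != j -> C5_adj i j} -> #|A| <= 2.
Proof.
move=> cA; rewrite leqNgt; apply/negP=> /card_gt2P[x [y [z [[xA yA zA] [xy yz zx]]]]].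
move: (cA _ _ xA yA xy) (cA _ _ yA zA yz) (cA _ _ zA xA zx) => {cA xA yA zA xy yz zx}.
case: x => [[|[|[|[|[|x]]]]] hx] //; case: y => [[|[|[|[|[|y]]]]] hy] //;
by case: z => [[|[|[|[|[|z]]]]] hz].
Qed.

Lemma C5_independent_card (A : {set 'I_5}) :
  {in A &, forall i j, ~~ C5_adj i j} -> #|A| <= 2.
Proof.
move=> iA; rewrite leqNgt; apply/negP=> /card_gt2P[x [y [z [[xA yA zA] [xy yz zx]]]]].
move: (iA _ _ xA yA) (iA _ _ yA zA) (iA _ _ zA xA) xy yz zx => {iA xA yA zA}.
case: x => [[|[|[|[|[|x]]]]] hx] //; case: y => [[|[|[|[|[|y]]]]] hy] //;
by case: z => [[|[|[|[|[|z]]]]] hz].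
Qed.

Lemma card_extremal_set (A : {set extremal_graph}) :
  #|A| = #|[set i | inl i \in A]| +
    (#|[set i | inr (inl i) \in A]| + #|[set i | inr (inr i) \in A]|).
Proof.
rewrite -sum1_card big_sumType big_sumType /= !sum1dep_card.
by rewrite !cardsE.
Qed.

(** A clique with an isolated vertex is a singleton; any other has at most two vertices on the
    5-cycle and at most [p] in the clique part. *)
Lemma extremal_clique_card (K : {set extremal_graph}) :
  is_clique K -> #|K| <= p.+2.
Proof.
move=> cK; have [|/set0Pn[s]] := eqVneq [set i | inr (inr i) \in K] set0.
  rewrite card_extremal_set => ->; rewrite cards0 addn0; apply: (@leq_add _ _ 2 p).
    apply: C5_clique_card => i j; rewrite !inE => iK jK ij.
    exact: (cK _ _ iK jK).
  by apply: leq_trans (max_card _) _; rewrite card_ord.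
rewrite inE => sK; have sub : K \subset [set inr (inr s)].
  apply/subsetP=> v vK; rewrite inE; apply: contraT => vs.
  by have := cK _ _ vK sK vs; case: v {vK vs} => [i|[i|i]].
by apply: leq_trans (subset_leq_card sub) _; rewrite cards1.
Qed.

(** Besides at most [q] isolated vertices, an independent set has either a single vertex of the
    clique part and none of the cycle, or at most two cycle vertices. *)
Lemma extremal_independent_card (S : {set extremal_graph}) :
  is_independent S -> #|S| <= q.+2.
Proof.
move=> iS; have cardr : #|[set i | inr (inr i) \in S]| <= q.
  by apply: leq_trans (max_card _) _; rewrite card_ord.
rewrite card_extremal_set addnA; apply: (@leq_add _ _ 2 q); last exact: cardr.
have [->|/set0Pn[k]] := eqVneq [set i | inr (inl i) \in S] set0.
  rewrite cards0 addn0; apply: C5_independent_card => i j; rewrite !inE.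
  exact: iS.
rewrite inE => kS.
have -> : [set i | inl i \in S] = set0.
  by apply/setP=> i; rewrite !inE; apply/negP=> iI; have := iS _ _ iI kS.
rewrite cards0 add0n; apply: (@leq_trans 1) => //.
have sub : [set i | inr (inl i) \in S] \subset [set k].
  apply/subsetP=> i; rewrite !inE => iI; have := iS _ _ iI kS.
  by rewrite /= negbK => /eqP[->].
by apply: leq_trans (subset_leq_card sub) _; rewrite cards1.
Qed.

End Extremal.

Theorem theorem5 (a b : nat) (ha : 3 <= a) (hb : 3 <= b) :
  is_ramsey_number (free_of [:: twoK2; C4]) a b (a + b).
Proof.
case: a ha => [//|[//|[//|p]]] _; case: b hb => [//|[//|[//|q]]] _.
split=> [|m bound_m]; first exact: ramsey_bound_add.
rewrite leqNgt; apply/negP=> m_lt.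
(* With [a = p + 3] and [b = q + 3], the order [5 + (p + q)] equals [a + b - 1], and the bounds
   [p.+2] and [q.+2] are [a - 1] and [b - 1]. *)
have m_le : m <= #|extremal_graph p q|.
  by rewrite card_extremal_graph; move: m_lt; rewrite !addnS ltnS.
have [[K cK cardK]|[S iS cardS]] := bound_m _ (extremal_graph_free p q) m_le.
  by have := extremal_clique_card _ _ _ cK; rewrite cardK ltnn.
by have := extremal_independent_card _ _ _ iS; rewrite cardS ltnn.
Qed.
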